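(* Let $\Sigma=\{A_j: j\in J\}$, $J=\{1,\dots,k\}$, be a finite CP set of real $n\times n$-matrices. Let $M_i$, $i=1,2,\dots$, be a sequence of products, where $M_i$ is a product of $i$ matrices from $\Sigma$, with the following property: for each $i$ there exists $m_i$, $0\le m_i\le i$, such that $M_i=M_-M_+$ and $M_{i+1}=M_-A_{j_i}M_+$, where $M_-$ is the product of the first $m_i$ factors of the product $M_i$, $M_+$ is the product of the last $i-m_i$ factors of the product $M_i$, and $A_{j_i}\in\Sigma$ (so the product $M_{i+1}$ is obtained from the product $M_i$ by inserting one matrix of $\Sigma$ at some place, the front and the rear positions included). Then $M_i$ converges to some $n\times n$-matrix as $i\to\infty$.
   Context: $\Sigma$ is LCP if for every sequence $j_1,j_2,\dots$ in $J$ the products $A_{j_m}\cdots A_{j_1}$ converge as $m\to\infty$; it is RCP if for every such sequence the products $A_{j_1}\cdots A_{j_m}$ converge as $m\to\infty$. For $J'\subseteq J$ let $N_{J'}=\bigcap_{j\in J'}N(I-A_j)$ (intersection of nullspaces) and let $R_{J'}$ be the linear span of the ranges $R(I-A_j)$, $j\in J'$. $\Sigma$ is transversal if $N_{J'}\oplus R_{J'}=\mathbb{R}^n$ for each $J'\subseteq J$. $\Sigma$ is CP if it is LCP, RCP and transversal. Products $M_i$ are understood as formal products (words of length $i$ over $\Sigma$) together with their matrix values; the empty product is the identity matrix $I$; convergence refers to the matrix values. *)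

(* Defs.v *)
From mathcomp Require Import all_boot all_order all_algebra.
From mathcomp Require Import all_classical all_reals all_analysis.
Import Order.TTheory GRing.Theory Num.Theory.
Import numFieldNormedType.Exports.

Set Implicit Arguments.
Unset Strict Implicit.
Unset Printing Implicit Defensive.

Local Open Scope classical_set_scope.
Local Open Scope ring_scope.

Section Products.
Variables (R : realType) (n k : nat).
Implicit Types (A : 'I_k -> 'M[R]_n) (J : {set 'I_k}).

(* A formal product A_{j_1} ... A_{j_m} is the word [:: j_1; ...; j_m]: the
   head of the word is the leftmost factor. *)
Definition word_value A (w : seq 'I_k) : 'M[R]_n :=
  \big[mulmx/1%:M]_(j <- w) A j.

(* In LCP and RCP, j 0, j 1, ... stands for the sequence j_1, j_2, .... *)
Definition LCP A : Prop := forall j : nat -> 'I_k,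
  cvgn (fun m => word_value A (rev (mkseq j m))).

Definition RCP A : Prop := forall j : nat -> 'I_k,
  cvgn (fun m => word_value A (mkseq j m)).

(* Matrices act on column vectors, by left multiplication. *)
Definition nullspace (B : 'M[R]_n) : {vspace 'cV[R]_n} :=
  lker (linfun (mulmx B : 'cV[R]_n -> 'cV[R]_n)).

Definition range_space (B : 'M[R]_n) : {vspace 'cV[R]_n} :=
  limg (linfun (mulmx B : 'cV[R]_n -> 'cV[R]_n)).

Definition common_nullspace A J : {vspace 'cV[R]_n} :=
  (\bigcap_(j in J) nullspace (1%:M - A j))%VS.

Definition span_ranges A J : {vspace 'cV[R]_n} :=
  (\sum_(j in J) range_space (1%:M - A j))%VS.

(* Directness is written as a trivial intersection: [directv] would unfold
   [span_ranges] and also require the inner sum of ranges to be direct. *)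
Definition transversal_family A : Prop := forall J,
  (common_nullspace A J :&: span_ranges A J)%VS = 0%VS /\
  (common_nullspace A J + span_ranges A J)%VS = fullv.

Definition CP A : Prop := [/\ LCP A, RCP A & transversal_family A].

End Products.

(* Main.v *)
Require Import Defs.
From mathcomp Require Import all_boot all_order all_algebra.
From mathcomp Require Import all_classical all_reals all_analysis.
From mathcomp Require Import lra.
Import Order.TTheory GRing.Theory Num.Theory.
Import numFieldNormedType.Exports.

Local Open Scope classical_set_scope.
Local Open Scope ring_scope.

(** Call a word over a set [J] of letters _rich_ when it contains, as a
    scattered subword, a high power of the word listing the letters of [J].

    Rich words are nearly projections. Let [P] be the projection onto the common
    nullspace of the [I - A j], [j] in [J], along the span of their ranges;
    then [w P = P = P w] for every word [w] over [J], so
    [w - P = w (I - P)]. Left products of an LCP set are uniformly bounded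
    ([LCP_bounded]). If arbitrarily rich words kept [w (I - P)] away from 0, a
    compactness argument would peel off, from the right, one factor containing
    all the letters of [J] while keeping that property ([persistent_extend]).
    Repeating this gives an infinite left product in which each letter of [J]
    occurs infinitely often, and whose limit [L] has [L (I - P) <> 0]. But each
    recurrent letter fixes the limit, [A j L = L], hence [P L = L]; as also
    [P L = P], this forces [L (I - P) = P (I - P) = 0], a contradiction
    ([complete_words_near_projection]).

    Growing words stabilise. Label each inserted letter with a rational number
    lying between the labels of its neighbours ([chain_of_insertions]). The words
    then become the finite stages of a growing set of labelled points on a line,
    so that every cut of the line cuts all the words coherently. Induct on the
    alphabet [J]. If the stages become arbitrarily rich, their values converge to
    the projection. Otherwise they all avoid a fixed word [a z]
    ([converges_avoiding]). Cut the line at the first point carrying [a], or, if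
    the points carrying [a] have no first element, at their infimum: on the left
    the letter [a] is missing, on the right the word [z] is avoided. By induction
    both sides converge, and the limit of the product is the product of the
    limits. *)

Set Implicit Arguments.
Unset Strict Implicit.
Unset Printing Implicit Defensive.

(** * A submultiplicative norm on square matrices *)

Section EntryNorm.
Variables (R : realType) (n : nat).
Implicit Types X Y : 'M[R]_n.

Definition entry_norm X : R := \sum_i \sum_j `|X i j|.

Lemma entry_norm_ge0 X : 0 <= entry_norm X.
Proof. by apply: sumr_ge0 => i _; apply: sumr_ge0. Qed.

Lemma entry_norm0 : entry_norm 0 = 0.
Proof.
by rewrite /entry_norm big1// => i _; rewrite big1// => j _; rewrite mxE normr0.
Qed.

Lemma entry_normD X Y : entry_norm (X + Y) <= entry_norm X + entry_norm Y.
Proof.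
rewrite /entry_norm -big_split; apply: ler_sum => i _ /=.
by rewrite -big_split; apply: ler_sum => j _ /=; rewrite mxE ler_normD.
Qed.

Lemma entry_normN X : entry_norm (- X) = entry_norm X.
Proof.
by apply: eq_bigr => i _; apply: eq_bigr => j _; rewrite mxE normrN.
Qed.

Lemma entry_normB X Y : entry_norm (X - Y) = entry_norm (Y - X).
Proof. by rewrite -entry_normN opprB. Qed.

Lemma entry_le_norm X i j : `|X i j| <= entry_norm X.
Proof.
rewrite /entry_norm; apply: (@le_trans _ _ (\sum_l `|X i l|)).
  by rewrite (bigD1 j)//= lerDl sumr_ge0.
rewrite [leRHS](bigD1 i)//= lerDl.
by apply: sumr_ge0 => l _; apply: sumr_ge0.
Qed.

Lemma entry_normM X Y : entry_norm (X *m Y) <= entry_norm X * entry_norm Y.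
Proof.
rewrite /entry_norm mulr_suml; apply: ler_sum => i _.
apply: (@le_trans _ _ (\sum_j \sum_l `|X i l| * `|Y l j|)).
  apply: ler_sum => j _; rewrite mxE; apply: le_trans (ler_norm_sum _ _ _) _.
  by apply: ler_sum => l _; rewrite normrM.
rewrite exchange_big mulr_suml; apply: ler_sum => l _ /=.
rewrite -mulr_sumr ler_wpM2l// [leRHS](bigD1 l)//= lerDl.
by apply: sumr_ge0 => l' _; apply: sumr_ge0.
Qed.

Lemma entry_norm_eq0 X : (forall e, 0 < e -> entry_norm X <= e) -> X = 0.
Proof.
move=> small; apply/matrixP => i j; rewrite mxE; apply/eqP.
rewrite -normr_le0; apply/ler_addgt0Pr => e e0; rewrite add0r.
exact: le_trans (entry_le_norm X i j) (small e e0).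
Qed.

Definition mx_limit (u : nat -> 'M[R]_n) (L : 'M[R]_n) : Prop :=
  forall e, 0 < e -> exists N, forall m, (N <= m)%N -> entry_norm (u m - L) < e.

(** Working with a submultiplicative norm instead of the entrywise uniform
    structure makes limits of products immediate. *)
Lemma mx_limitP (u : nat -> 'M[R]_n) (L : 'M[R]_n) :
  mx_limit u L <-> (u @ \oo --> L).
Proof.
split=> [uL|/cvg_ballP uL e e0].
  apply/cvg_ballP => e e0; have [N uN] := uL e e0.
  exists N => // m /= Nm; split=> // i j.
  rewrite /ball/= /ball_; apply: le_lt_trans (uN m Nm).
  by rewrite entry_normB; apply: le_trans (entry_le_norm _ i j); rewrite !mxE.
have c0 : 0 < (n * n).+1%:R :> R by rewrite ltr0n.
have [N _ uN] := uL _ (divr_gt0 e0 c0).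
exists N => m Nm; have [_ close] := uN m Nm.
apply: (@le_lt_trans _ _ (\sum_(i < n) \sum_(j < n) (e / (n * n).+1%:R))).
  apply: ler_sum => i _; apply: ler_sum => j _.
  by have := close i j; rewrite /ball/= /ball_ !mxE distrC => /ltW.
rewrite !sumr_const !card_ord -mulrnA -[_ *+ (n * n)]mulr_natl mulrCA gtr_pMr//.
by rewrite ltr_pdivrMr// mul1r ltr_nat.
Qed.

Lemma mx_limit_bounded u L : mx_limit u L ->
  exists C, forall m, entry_norm (u m) <= C.
Proof.
move=> /(_ 1 ltr01)[N uN].
exists (1 + entry_norm L + \sum_(m < N) entry_norm (u m)) => m.
have s0 : 0 <= \sum_(m < N) entry_norm (u m).
  by apply: sumr_ge0 => l _; apply: entry_norm_ge0.
have [Nm|mN] := leqP N m.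
  have := uN m Nm; have := entry_normD (u m - L) L; rewrite subrK; lra.
have -> : \sum_(m < N) entry_norm (u m) =
  entry_norm (u m) + \sum_(l < N | l != Ordinal mN) entry_norm (u l).
  by rewrite (bigD1 (Ordinal mN)).
have : 0 <= \sum_(l < N | l != Ordinal mN) entry_norm (u l).
  by apply: sumr_ge0 => l _; apply: entry_norm_ge0.
have := entry_norm_ge0 L; lra.
Qed.

Lemma mx_limit_unique u L L' : mx_limit u L -> mx_limit u L' -> L = L'.
Proof.
move=> uL uL'; apply/subr0_eq/entry_norm_eq0 => e e0.
have e2 : 0 < e / 2 by rewrite divr_gt0.
have [N uN] := uL _ e2; have [N' uN'] := uL' _ e2.
have := uN _ (leq_maxl N N'); have := uN' _ (leq_maxr N N').
set M := u _; have := entry_normD (L - M) (M - L').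
rewrite (entry_normB L M) addrA subrK; lra.
Qed.

Lemma mx_limit_subseq u L (s : nat -> nat) :
  (forall m, (m <= s m)%N) -> mx_limit u L -> mx_limit (u \o s) L.
Proof.
move=> ms uL e /uL[N uN]; exists N => m Nm; apply: uN.
exact: leq_trans Nm (ms m).
Qed.

Lemma mx_limit_near_cst u L N : (forall m, (N <= m)%N -> u m = L) ->
  mx_limit u L.
Proof.
by move=> uL e e0; exists N => m /uL->; rewrite subrr entry_norm0.
Qed.

Lemma mx_limitM u v L M : mx_limit u L -> mx_limit v M ->
  mx_limit (fun m => u m *m v m) (L *m M).
Proof.
move=> uL vM; have [C uC] := mx_limit_bounded uL.
have C0 : 0 <= C by apply: le_trans (uC 0%N); apply: entry_norm_ge0.
have M0 := entry_norm_ge0 M.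
move=> e e0; pose d := e / (C + entry_norm M + 1).
have D0 : 0 < C + entry_norm M + 1 by lra.
have d0 : 0 < d by apply: divr_gt0.
have [N uN] := uL _ d0; have [N' vN] := vM _ d0.
exists (maxn N N') => m; rewrite geq_max => /andP[/uN um /vN vm].
have -> : u m *m v m - L *m M = u m *m (v m - M) + (u m - L) *m M.
  by rewrite mulmxBr mulmxBl addrA subrK.
apply: le_lt_trans (entry_normD _ _) _.
have h1 := entry_normM (u m) (v m - M); have h2 := entry_normM (u m - L) M.
have h3 : entry_norm (u m) * entry_norm (v m - M) <= C * d.
  by apply: ler_pM; rewrite ?entry_norm_ge0// ltW.
have h4 : entry_norm (u m - L) * entry_norm M <= d * entry_norm M.
  by rewrite ler_wpM2r// ltW.
have h5 : d * (C + entry_norm M + 1) = e by rewrite divfK// gt_eqF.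
lra.
Qed.

End EntryNorm.

(** * Infinite words and subwords *)

Section InfiniteWords.
Variable T : eqType.
Implicit Types u v : seq T.

(** Dependent choice for words: if words with property [Q] can always be extended
    keeping [Q], the successive extensions glue to one infinite word. The index [m]
    lets the demand [S] on the extension vary with the stage. *)
Lemma infinite_word_of_extensions (Q : seq T -> Prop)
    (S : nat -> seq T -> seq T -> Prop) :
  Q [::] ->
  (forall m u, Q u -> exists v, [/\ v != [::], Q (u ++ v) & S m u v]) ->
  exists j : nat -> T, forall m, exists t v, [/\ (m <= t)%N,
    Q (mkseq j t), S m (mkseq j t) v & mkseq j (t + size v) = mkseq j t ++ v].
Proof.
move=> Q0 ext; have [v0 [v0N _ _]] := ext 0%N _ Q0.
have [x0 _] : {x | x = head x v0} by case: v0 v0N => // x; exists x.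
pose next (p q : nat * {u | Q u}) := q.1 = p.1.+1 /\
  exists v, [/\ v != [::], sval q.2 = sval p.2 ++ v & S p.1 (sval p.2) v].
have [p|f [f0 fS]] := @dependent_choice _ next _ (0%N, exist _ _ Q0).
  apply: cid; case: p => m [u Qu]; have [v [v0' Quv Sv]] := ext m u Qu.
  by exists (m.+1, exist _ _ Quv); split=> //=; exists v.
have f1 m : (f m).1 = m by elim: m => [|m IHm]; rewrite ?f0// (fS m).1 IHm.
pose U m := sval (f m).2.
have US m : exists v, [/\ v != [::], U m.+1 = U m ++ v & S m (U m) v].
  by have := (fS m).2; rewrite f1.
have sizeU m : (m <= size (U m))%N.
  elim: m => // m IHm; have [v [vN -> _]] := US m.
  case: v vN => // x v _.
  by rewrite size_cat addnS ltnS (leq_trans IHm)// leq_addr.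
have nthU m d t : (t < size (U m))%N -> nth x0 (U (m + d)%N) t = nth x0 (U m) t.
  move=> tm; suff [s ->] : exists s, U (m + d)%N = U m ++ s by rewrite nth_cat tm.
  elim: d => [|d [s Us]]; first by exists [::]; rewrite addn0 cats0.
  have [v [_ Uv _]] := US (m + d)%N.
  by exists (s ++ v); rewrite addnS Uv Us catA.
(* The prefix [U t.+1] has more than [t] letters, so [x0] is never read. *)
pose j t := nth x0 (U t.+1) t.
have jU m : mkseq j (size (U m)) = U m.
  apply: (@eq_from_nth _ x0); rewrite size_mkseq// => t tm.
  rewrite nth_mkseq// /j; have [/subnKC <-|/ltnW/subnKC <-] := leqP m t.+1.
    by rewrite nthU.
  by rewrite nthU// (leq_trans _ (sizeU _)).
exists j => m; have [v [_ Uv Sv]] := US m.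
exists (size (U m)), v; split=> //; rewrite ?jU//; first exact: (svalP (f m).2).
by rewrite -size_cat -Uv jU.
Qed.

Lemma subseq_catP u v w : subseq (u ++ v) w ->
  exists w1 w2, [/\ w = w1 ++ w2, subseq u w1 & subseq v w2].
Proof.
elim: w u => [|x w IHw] [|y u]/=; do ?by [exists [::], [::]].
- by exists [::], (x :: w).
- case: eqP => [->|yx].
    by move=> /IHw[w1 [w2 [-> uw1 vw2]]]; exists (x :: w1), w2; rewrite /= eqxx.
  move=> /(IHw (y :: u))[w1 [w2 [-> uw1 vw2]]]; exists (x :: w1), w2.
  by rewrite /= (introF eqP yx).
Qed.

Lemma infinite_pigeonhole (F : finType) (f : nat -> F) :
  exists x, forall q, exists m, (q <= m)%N /\ f m = x.
Proof.
apply: contrapT => none.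
have {none} fin x : exists q, forall m, (q <= m)%N -> f m <> x.
  apply: contrapT => nox; apply: none; exists x => q; apply: contrapT => noq.
  by apply: nox; exists q => m qm fm; apply: noq; exists m.
have [b bP] := choice fin.
set m := (\max_x b x)%N.
by have /(_ (leq_bigmax _)) := bP (f m) m.
Qed.

End InfiniteWords.

(** * Left convergent products are uniformly bounded *)

Section Words.
Variables (R : realType) (n k : nat) (A : 'I_k -> 'M[R]_n).
Implicit Types (u v w : seq 'I_k) (X : 'M[R]_n).
Local Notation wv := (word_value A).

Lemma word_value_cons a w : wv (a :: w) = A a *m wv w.
Proof. by rewrite /word_value big_cons. Qed.

Lemma word_value_nil : wv [::] = 1%:M.
Proof. by rewrite /word_value big_nil. Qed.

Lemma word_value_cat u v : wv (u ++ v) = wv u *m wv v.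
Proof.
elim: u => [|a u IHu]; first by rewrite word_value_nil mul1mx.
by rewrite cat_cons !word_value_cons IHu mulmxA.
Qed.

Definition orbit_bounded X := exists C, forall w, entry_norm (wv w *m X) <= C.

Lemma orbit_bounded_mulr X Y : orbit_bounded X -> orbit_bounded (X *m Y).
Proof.
move=> [C XC]; exists (C * entry_norm Y) => w.
rewrite mulmxA; apply: le_trans (entry_normM _ _) _.
by rewrite ler_wpM2r// entry_norm_ge0.
Qed.

Lemma orbit_boundedD X Y :
  orbit_bounded X -> orbit_bounded Y -> orbit_bounded (X + Y).
Proof.
move=> [C XC] [D YD]; exists (C + D) => w; rewrite mulmxDr.
exact: le_trans (entry_normD _ _) (lerD (XC w) (YD w)).
Qed.

(** The matrices with a bounded orbit are closed under addition and right
    multiplication, so one of maximal rank, [B], left-divides all the others: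
    [X = B Y] with [Y] depending linearly on [X]. A bound for the orbit of the
    single matrix [B] therefore serves for all of them. *)
Lemma orbit_bounded_uniform : exists K, 0 <= K /\
  forall X, orbit_bounded X -> forall w, entry_norm (wv w *m X) <= K * entry_norm X.
Proof.
pose P r := `[< exists2 X, orbit_bounded X & \rank X = r >].
have exP : exists r, P r.
  exists 0%N; apply/asboolP; exists 0; last by rewrite mxrank0.
  by exists 0 => w; rewrite mulmx0 entry_norm0.
have leP r : P r -> (r <= n)%N by move=> /asboolP[X _ <-]; rewrite rank_leq_row.
case: (ex_maxnP exP leP) => r /asboolP[B obB <-] maxB.
(* Otherwise the column spaces of [B] and [X] would span together the column
   space of a matrix with a bounded orbit and a larger rank. *)
have factor X : orbit_bounded X -> X = B *m ((pinvmx B^T)^T *m X).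
  move=> obX; set Z := (B^T + X^T)%MS.
  have ZB : (Z <= B^T)%MS.
    have BZ : (B^T <= Z)%MS by rewrite addsmxSl.
    rewrite -(geq_leqif (mxrank_leqif_sup BZ)) mxrank_tr -(mxrank_tr Z).
    apply: maxB; apply/asboolP; exists Z^T => //.
    have /sub_addsmxP[[y z] /= ->] := submx_refl Z.
    rewrite linearD/= !trmx_mul !trmxK.
    by apply: orbit_boundedD; apply: orbit_bounded_mulr.
  have /mulmxKpV XB : (X^T <= B^T)%MS by rewrite (submx_trans _ ZB)// addsmxSr.
  by rewrite -[LHS]trmxK -XB !trmx_mul !trmxK.
have [C BC] := obB.
have C0 : 0 <= C by apply: le_trans (BC [::]); apply: entry_norm_ge0.
exists (C * entry_norm (pinvmx B^T)^T); split=> [|X obX w].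
  by rewrite mulr_ge0// entry_norm_ge0.
rewrite {1}(factor X obX) mulmxA -mulrA; apply: le_trans (entry_normM _ _) _.
by apply: ler_pM; rewrite ?entry_norm_ge0// entry_normM.
Qed.

(** An unbounded orbit has large points whose own orbit is unbounded. If those
    points stayed below [c], then so would, up to the constant of
    [orbit_bounded_uniform], the points with bounded orbits: a path reaches them
    by applying one letter to a point of norm at most [c]. *)
Lemma unbounded_orbit_escape X c : ~ orbit_bounded X ->
  exists w, c <= entry_norm (wv w *m X) /\ ~ orbit_bounded (wv w *m X).
Proof.
move=> nobX; apply: contrapT => none; apply: (nobX).
have small w : ~ orbit_bounded (wv w *m X) -> entry_norm (wv w *m X) <= c.
  by move=> nob; rewrite leNgt; apply/negP => /ltW cw; apply: none; exists w.
have c0 : 0 <= c.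
  apply: le_trans (small [::] _); first exact: entry_norm_ge0.
  by rewrite word_value_nil mul1mx.
have [K [K0 obK]] := orbit_bounded_uniform.
pose S := \sum_a entry_norm (A a).
have AS a : entry_norm (A a) <= S.
  by rewrite /S (bigD1 a)//= lerDl sumr_ge0// => b _; apply: entry_norm_ge0.
have S0 : 0 <= S by apply: sumr_ge0 => a _; apply: entry_norm_ge0.
have split_path w : ~ orbit_bounded (wv w *m X) \/
    exists v Y, [/\ orbit_bounded Y, entry_norm Y <= S * c & wv w *m X = wv v *m Y].
  elim: w => [|a w [nob|[v [Y [obY Yc wY]]]]].
  - by left; rewrite word_value_nil mul1mx.
  - rewrite word_value_cons -mulmxA.
    have [ob|] := pselect (orbit_bounded (A a *m (wv w *m X))); last by left.
    right; exists [::], (A a *m (wv w *m X)).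
    rewrite word_value_nil mul1mx; split=> //.
    apply: le_trans (entry_normM _ _) _.
    by apply: ler_pM; rewrite ?entry_norm_ge0// small.
  - by right; exists (a :: v), Y; rewrite !word_value_cons -!mulmxA wY.
exists (c + K * (S * c)) => w.
have [/small wc|[v [Y [obY Yc ->]]]] := split_path w.
  by apply: le_trans wc _; rewrite lerDl !mulr_ge0.
by apply: le_trans (obK _ obY v) _; rewrite ler_wpDl// ler_wpM2l.
Qed.

(** If the products were unbounded, then escaping repeatedly would build one
    infinite left product with unbounded partial products. *)
Lemma LCP_bounded : LCP A -> exists C, forall w, entry_norm (wv w) <= C.
Proof.
move=> lcpA; suff [C wC] : orbit_bounded 1%:M.
  by exists C => w; rewrite -[wv w]mulmx1.
apply: contrapT => nob.
pose S m u v := m%:R <= entry_norm (wv (rev (u ++ v))).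
have [||j jP] := @infinite_word_of_extensions _
    (fun u => ~ orbit_bounded (wv (rev u))) S.
- by rewrite word_value_nil.
- move=> m u /(unbounded_orbit_escape (entry_norm (wv (rev u)) + 1 + m%:R)).
  move=> [w [wc nobw]]; exists (rev w).
  rewrite /S rev_cat revK word_value_cat; split=> //.
    case: w wc {nobw} => [|a w] wc.
      move: wc; rewrite word_value_nil mul1mx.
      by have : 0 <= m%:R :> R by []; lra.
    by rewrite -size_eq0 size_rev.
  by apply: le_trans wc; have := entry_norm_ge0 (wv (rev u)); lra.
have /cvg_ex[L /mx_limitP/mx_limit_bounded[C jC]] := lcpA j.
have C0 : 0 <= C by apply: le_trans (jC 0%N); apply: entry_norm_ge0.
have [t [v [_ _ Sv jv]]] := jP (Num.bound C).
have := le_lt_trans (jC (t + size v)%N) (archi_boundP C0).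
by rewrite jv ltNge => /negP; apply.
Qed.

End Words.

(** * Words rich in an alphabet are close to a projection *)

Section BoundedSequences.
Variables (R : realType) (n : nat).

(** Compactness of bounded sets of matrices, in the form used below: infinitely many
    terms lie close to one and the same term. Round the entries to a grid and
    apply the pigeonhole principle. *)
Lemma bounded_seq_clusters (u : nat -> 'M[R]_n) C e :
  (forall m, entry_norm (u m) <= C) -> 0 < e ->
  exists p, forall q, exists m, (q <= m)%N /\ entry_norm (u m - u p) <= e.
Proof.
move=> uC e0; have c0 : 0 < (n * n).+1%:R :> R by rewrite ltr0n.
pose h := e / (n * n).+1%:R; have h0 : 0 < h by apply: divr_gt0.
have C0 : 0 <= C by apply: le_trans (uC 0%N); apply: entry_norm_ge0.
pose y m i j := (u m i j + C) / h.
have entryC m i j : `|u m i j| <= C by apply: le_trans (uC m); apply: entry_le_norm.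
have y0 m i j : 0 <= y m i j.
  rewrite /y divr_ge0 ?(ltW h0)//.
  by have := entryC m i j; rewrite ler_norml => /andP[]; lra.
pose b := Num.bound ((C + C) / h).
have yb m i j : (Num.truncn (y m i j) < b.+1)%N.
  rewrite ltnS -(ler_nat R); have /andP[ty _] := truncn_itv (y0 m i j).
  apply: le_trans ty _; apply: ltW; apply: le_lt_trans (archi_boundP _).
    rewrite /y ler_wpM2r ?invr_ge0 ?(ltW h0)//.
    by have := entryC m i j; rewrite ler_norml => /andP[]; lra.
  by rewrite divr_ge0 ?addr_ge0// ltW.
pose f m : {ffun 'I_n * 'I_n -> 'I_b.+1} :=
  [ffun ij => inord (Num.truncn (y m ij.1 ij.2))].
have [x fx] := infinite_pigeonhole f.
have [p [_ fp]] := fx 0%N; exists p => q; have [m [qm fm]] := fx q.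
exists m; split=> //.
apply: (@le_trans _ _ (\sum_(i < n) \sum_(j < n) h)); last first.
  rewrite !sumr_const !card_ord -mulrnA -[_ *+ (n * n)]mulr_natl /h mulrCA.
  by rewrite ger_pMr// ler_pdivrMr// mul1r ler_nat.
apply: ler_sum => i _; apply: ler_sum => j _; rewrite !mxE.
have eq_trunc : Num.truncn (y m i j) = Num.truncn (y p i j).
  have := congr1 (fun g : {ffun 'I_n * 'I_n -> 'I_b.+1} => val (g (i, j)))
    (etrans fm (esym fp)).
  by rewrite !ffunE /= !inordK.
have /andP[m1 m2] := truncn_itv (y0 m i j).
have /andP[p1 p2] := truncn_itv (y0 p i j).
have -> : u m i j - u p i j = (y m i j - y p i j) * h.
  by rewrite -mulrBl opprD addrACA subrr addr0 divfK// gt_eqF.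
rewrite normrM (gtr0_norm h0) ger_pMl// ler_norml.
move: m1 m2 p1 p2; rewrite eq_trunc -natr1; lra.
Qed.

End BoundedSequences.

Section CompleteWords.
Variables (R : realType) (n k : nat) (A : 'I_k -> 'M[R]_n).
Implicit Types (J : {set 'I_k}) (w : seq 'I_k) (P X : 'M[R]_n).
Local Notation wv := (word_value A).

Definition fixing_projection J P : Prop :=
  [/\ forall a, a \in J -> A a *m P = P,
      forall a, a \in J -> P *m A a = P &
      forall X, (forall a, a \in J -> A a *m X = X) -> P *m X = X].

Lemma mulmx_cV_inj X Y : (forall x : 'cV_n, X *m x = Y *m x) -> X = Y.
Proof.
move=> XY; apply/matrixP => i j.
by have /(congr1 (fun M : 'cV_n => M i 0)) := XY (delta_mx j 0); rewrite -!colE !mxE.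
Qed.

(** The projection onto the common nullspace along the span of the ranges. *)
Lemma transversal_projection J : transversal_family A ->
  exists P, fixing_projection J P.
Proof.
move=> /(_ J); set N := common_nullspace A J; set V := span_ranges A J.
move=> [NV0 NVT]; pose f := daddv_pi N V.
have VN0 : (V :&: N)%VS = 0%VS by rewrite capvC.
pose P : 'M[R]_n := \matrix_(i, j) f (delta_mx j 0) i 0.
have PE x : P *m x = f x.
  rewrite {2}[x]matrix_sum_delta linear_sum /=.
  apply/matrixP => i j; rewrite !mxE summxE; apply: eq_bigr => l _.
  by rewrite (ord1 j) !mxE big_ord1 linearZ /= !mxE mulrC.
have memN x : (x \in N) <-> forall a, a \in J -> A a *m x = x.
  rewrite /N /common_nullspace; split=> [/subv_bigcapP xN a aJ|fix_x].
    have := xN a aJ.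
    rewrite /nullspace -memvE memv_ker lfunE /= mulmxBl mul1mx subr_eq0.
    by move=> /eqP.
  rewrite memvE; apply/subv_bigcapP => a aJ.
  by rewrite -memvE memv_ker lfunE /= mulmxBl mul1mx fix_x// subrr.
have fN x : f x \in N by apply: memv_pi.
have fid x : x \in N -> f x = x by apply: daddv_pi_id.
have fV x : x \in V -> f x = 0.
  move=> xV; have := @daddv_pi_add _ _ N V x NV0.
  rewrite NVT memvf => /(_ isT).
  by rewrite (daddv_pi_id VN0 xV) -/f => /(canRL (addrK _)); rewrite subrr.
have memV a x : a \in J -> (1%:M - A a) *m x \in V.
  move=> aJ; apply: subvP (sumv_sup a aJ (subvv _)) _ _.
  have := memv_img (linfun (mulmx (1%:M - A a) : 'cV_n -> 'cV_n)) (memvf x).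
  by rewrite lfunE.
exists P; split=> [a aJ|a aJ|X fixX]; apply: mulmx_cV_inj => x.
- by rewrite -mulmxA PE; apply: (memN _).1.
- apply/eqP; rewrite -mulmxA -subr_eq0 -opprB oppr_eq0 -mulmxBr.
  by rewrite -{1}[x]mul1mx -mulmxBl PE fV// memV.
- rewrite -mulmxA PE fid//; apply/memN => a aJ.
  by rewrite mulmxA fixX.
Qed.

Section OneAlphabet.
Variables (J : {set 'I_k}) (P : 'M[R]_n).
Hypothesis fixP : fixing_projection J P.

Lemma word_value_projection w : all (mem J) w -> wv w *m P = P.
Proof.
case: fixP => AP _ _; elim: w => [|a w IHw] /=.
  by rewrite word_value_nil mul1mx.
by move=> /andP[aJ wJ]; rewrite word_value_cons -mulmxA IHw// AP.
Qed.

Lemma projection_word_value w : all (mem J) w -> P *m wv w = P.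
Proof.
case: fixP => _ PA _; elim: w => [|a w IHw] /=.
  by rewrite word_value_nil mulmx1.
by move=> /andP[aJ wJ]; rewrite word_value_cons mulmxA PA// IHw.
Qed.

(** Applying [a] maps infinitely many partial products to later partial products,
    and both subsequences tend to [L]. *)
Lemma recurrent_letter_fixes_limit (j : nat -> 'I_k) a L :
  mx_limit (fun m => wv (rev (mkseq j m))) L ->
  (forall N, exists t, (N <= t)%N /\ j t = a) -> A a *m L = L.
Proof.
move=> jL /choice[s sP].
have sS m : (m <= (s m).+1)%N by rewrite ltnW// ltnS (sP m).1.
apply: mx_limit_unique (mx_limit_subseq sS jL).
have cstA := @mx_limit_near_cst _ _ (fun=> A a) (A a) 0%N (fun _ _ => erefl).
have := mx_limitM cstA (mx_limit_subseq (fun m => (sP m).1) jL).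
move=> AL e /AL[N NP]; exists N => m /NP.
by rewrite /= mkseqS rev_rcons word_value_cons (sP m).2.
Qed.

Lemma recurrent_alphabet_limit (j : nat -> 'I_k) L :
  mx_limit (fun m => wv (rev (mkseq j m))) L ->
  (forall t, j t \in J) ->
  (forall a, a \in J -> forall N, exists t, (N <= t)%N /\ j t = a) ->
  L *m (1%:M - P) = 0.
Proof.
move=> jL jJ jrec; case: (fixP) => _ _ fixed.
have PL : P *m L = L.
  by apply: fixed => a aJ; apply: recurrent_letter_fixes_limit jL (jrec a aJ).
have PLP : P *m L = P.
  have cstP := @mx_limit_near_cst _ _ (fun=> P) P 0%N (fun _ _ => erefl).
  apply: mx_limit_unique (mx_limitM cstP jL) _.
  apply: (@mx_limit_near_cst _ _ _ _ 0%N) => m _.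
  apply: projection_word_value; rewrite all_rev; apply/allP => b.
  by move=> /mapP[t _ ->]; apply: jJ.
have PP : P *m P = P by apply: fixed => a aJ; case: fixP => AP _ _; apply: AP.
by rewrite -PL PLP mulmxBr mulmx1 PP subrr.
Qed.

Definition alphabet_power q : seq 'I_k := flatten (nseq q (enum J)).

Lemma alphabet_powerS q : alphabet_power q.+1 = alphabet_power q ++ enum J.
Proof. by rewrite /alphabet_power -addn1 nseqD flatten_cat /= cats0. Qed.

Lemma subseq_alphabet_power q r : (q <= r)%N ->
  subseq (alphabet_power q) (alphabet_power r).
Proof.
move=> /subnKC <-; rewrite /alphabet_power nseqD flatten_cat.
exact: prefix_subseq.
Qed.

(** Arbitrarily rich words still keep [X] away from 0. *)
Definition persistent d X := forall q, exists w,
  [/\ all (mem J) w, subseq (alphabet_power q) w & d <= entry_norm (wv w *m X)].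

(** Split a word of richness [q + 1] as [w1 w2], where [w1] has richness [q] and
    [w2] contains all the letters of [J]. The factor [w2] depends on [q], but the
    matrices [w2 X] are bounded, so infinitely many of them lie near a single one;
    as the words [w1] are bounded too, that one can replace the others at an
    arbitrarily small loss [d - d']. *)
Lemma persistent_extend C d d' X :
  (forall w, entry_norm (wv w) <= C) -> d' < d -> persistent d X ->
  exists w, [/\ all (mem J) w, subseq (enum J) w & persistent d' (wv w *m X)].
Proof.
move=> wC dd' perX.
have C0 : 0 <= C by apply: le_trans (wC [::]); apply: entry_norm_ge0.
have X0 := entry_norm_ge0 X.
have /choice[b bP] q : exists b : seq 'I_k * seq 'I_k,
    [/\ all (mem J) b.1 && all (mem J) b.2, subseq (alphabet_power q) b.1,
        subseq (enum J) b.2 & d <= entry_norm (wv b.1 *m (wv b.2 *m X))].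
  have [w [wJ]] := perX q.+1; rewrite alphabet_powerS => /subseq_catP.
  move=> [w1 [w2 [wE qw1 Jw2]]] dw; exists (w1, w2); split=> //=.
    by rewrite -all_cat -wE.
  by rewrite mulmxA -word_value_cat -wE.
have C1 : 0 < C + 1 by lra.
have [||p pP] := @bounded_seq_clusters _ _ (fun q => wv (b q).2 *m X)
    (C * entry_norm X) ((d - d') / (C + 1)).
- by move=> q; apply: le_trans (entry_normM _ _) _; rewrite ler_wpM2r.
- by rewrite divr_gt0// subr_gt0.
have [/andP[_ pJ] _ Jp _] := bP p.
exists (b p).2; split=> // q; have [m [qm close]] := pP q.
have [/andP[mJ _] zm _ dm] := bP m.
exists (b m).1; split=> //.
  exact: subseq_trans (subseq_alphabet_power qm) zm.
set Y := wv (b m).2 *m X in dm close; set Z := wv (b p).2 *m X in close *.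
have -> : wv (b m).1 *m Z = wv (b m).1 *m Y - wv (b m).1 *m (Y - Z).
  by rewrite mulmxBr subKr.
have h1 := entry_normM (wv (b m).1) (Y - Z).
have h2 : entry_norm (wv (b m).1) * entry_norm (Y - Z) <=
    C * ((d - d') / (C + 1)) by apply: ler_pM; rewrite ?entry_norm_ge0.
have h3 : (C + 1) * ((d - d') / (C + 1)) = d - d'.
  by rewrite mulrC divfK// gt_eqF.
have h4 : 0 <= (d - d') / (C + 1) by rewrite ltW// divr_gt0// subr_gt0.
have := entry_normD (wv (b m).1 *m Y - wv (b m).1 *m (Y - Z))
  (wv (b m).1 *m (Y - Z)).
rewrite subrK; lra.
Qed.

Lemma complete_words_near_projection e : LCP A -> 0 < e ->
  exists q, forall w, all (mem J) w -> subseq (alphabet_power q) w ->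
    entry_norm (wv w - P) < e.
Proof.
move=> lcpA e0; apply: contrapT => far.
have wE w : all (mem J) w -> wv w - P = wv w *m (1%:M - P).
  by move=> wJ; rewrite mulmxBr mulmx1 word_value_projection.
have per_e : persistent e (1%:M - P).
  move=> q; apply: contrapT => none; apply: far; exists q => w wJ qw.
  rewrite ltNge; apply/negP => ew; apply: none; exists w.
  by rewrite -wE.
have [J0|[a0 a0J]] := set_0Vmem J.
  have [w [wJ _]] := per_e 0%N; rewrite -wE//.
  have -> : P = 1%:M.
    case: fixP => _ _ fixed; rewrite -[P]mulmx1; apply: fixed => a.
    by rewrite J0 inE.
  have -> : w = [::].
    by case: w wJ => // a w; rewrite J0 /= inE.
  by rewrite word_value_nil subrr entry_norm0 leNgt e0.
have [C wC] := LCP_bounded lcpA.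
have C0 : 0 <= C by apply: le_trans (wC [::]); apply: entry_norm_ge0.
(* The losses are kept summable by requiring only that [d] stay above [e / 2]:
   each step moves [d] halfway towards that threshold. *)
pose Q u := all (mem J) u /\
  exists d, e / 2 < d /\ persistent d (wv (rev u) *m (1%:M - P)).
pose S (m : nat) (u v : seq 'I_k) := forall a, a \in J -> a \in v.
have [||j jP] := @infinite_word_of_extensions _ Q S.
- split=> //; exists e; split; first lra.
  by rewrite word_value_nil mul1mx.
- move=> m u [uJ [d [ed peru]]].
  have [|w [wJ Jw perw]] := @persistent_extend C d ((d + e / 2) / 2) _ wC _ peru.
    by lra.
  have JwP a : a \in J -> a \in rev w.
    by move=> aJ; rewrite mem_rev (mem_subseq Jw)// mem_enum.
  exists (rev w); split=> //.
    by apply: contraTneq (JwP a0 a0J) => ->.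
  split; first by rewrite all_cat uJ all_rev.
  exists ((d + e / 2) / 2); split; first lra.
  by rewrite rev_cat revK word_value_cat -mulmxA.
have /cvg_ex[L /mx_limitP jL] := lcpA j.
have L0 : L *m (1%:M - P) = 0.
  apply: recurrent_alphabet_limit jL _ _ => [t|a aJ N].
    have [t' [v [tt' [/allP uJ _] _ _]]] := jP t.+1.
    by apply: uJ; apply: map_f; rewrite mem_iota.
  have [t [v [Nt _ Sv jv]]] := jP N.
  have av := Sv a aJ; exists (t + index a v)%N; split.
    exact: leq_trans Nt (leq_addr _ _).
  have := congr1 (fun s => nth a s (t + index a v)) jv.
  rewrite /= nth_mkseq ?ltn_add2l ?index_mem// nth_cat size_mkseq.
  by rewrite ltnNge leq_addr /= addKn nth_index.
have C1 : 0 < C + 1 by lra.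
have e2 : 0 < e / 2 / (C + 1) by rewrite !divr_gt0.
have := mx_limitM jL (@mx_limit_near_cst _ _ (fun=> 1%:M - P) _ 0%N
  (fun _ _ => erefl)).
rewrite L0 => /(_ _ e2)[N NP].
have [t [v [/NP small [_ [d [ed pert]]] _ _]]] := jP N.
have [w [_ _ dw]] := pert 0%N.
move: small dw; rewrite subr0; set X := _ *m (1%:M - P) => small dw.
have h1 := entry_normM (wv w) X.
have h2 : entry_norm (wv w) * entry_norm X <= C * (e / 2 / (C + 1)).
  by apply: ler_pM; rewrite ?entry_norm_ge0// ltW.
have h3 : (C + 1) * (e / 2 / (C + 1)) = e / 2 by rewrite mulrC divfK// gt_eqF.
lra.
Qed.

End OneAlphabet.
End CompleteWords.

(** * Growing families of labelled points on a line *)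

Section Chains.
Variables (d : Order.disp_t) (T : orderType d).
Implicit Types (s t : seq T) (D : pred T) (r : nat -> seq T).
Local Open Scope order_scope.

Lemma sorted_subset_subseq s t :
  sorted <%O s -> sorted <%O t -> {subset s <= t} -> subseq s t.
Proof.
move=> ss st sub_st; suff -> : s = [seq x <- t | x \in s] by apply: filter_subseq.
apply: lt_sorted_eq => //; first exact: lt_sorted_filter.
by move=> x; rewrite mem_filter; case: (boolP (x \in s)) => // /sub_st ->.
Qed.

Lemma filter_downset D s : (forall x y, x < y -> D y -> D x) ->
  sorted <%O s -> s = seq.filter D s ++ seq.filter (predC D) s.
Proof.
move=> downD; elim: s => //= x s IHs xs.
have ss := path_sorted xs; case: ifPn => Dx; first by rewrite {1}(IHs ss).
rewrite /= (_ : seq.filter D s = [::]); last first.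
  apply/eqP; rewrite -[_ == _]negbK -has_filter; apply/hasPn => y ys.
  by apply: contra Dx; apply: downD; apply: (allP (order_path_min lt_trans xs)).
congr cons; rewrite (@eq_in_filter _ _ xpredT) ?filter_predT// => y ys /=.
by apply: contra Dx; apply: downD; apply: (allP (order_path_min lt_trans xs)).
Qed.

Definition chain r : Prop :=
  (forall i, sorted <%O (r i)) /\ (forall i, {subset r i <= r i.+1}).

Lemma chain_le r i i' : chain r -> (i <= i')%N -> {subset r i <= r i'}.
Proof.
move=> [_ subr] /subnKC <-; elim: (i' - i)%N => [|m IHm] x; first by rewrite addn0.
by move=> /IHm /subr; rewrite addnS.
Qed.

Lemma chain_filter D r : chain r -> chain (fun i => seq.filter D (r i)).
Proof.
move=> [sr subr]; split=> i; first exact: lt_sorted_filter.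
by move=> x; rewrite !mem_filter => /andP[-> /subr].
Qed.

End Chains.

Section ChainConvergence.
Variables (R : realType) (n k : nat) (A : 'I_k -> 'M[R]_n).
Variables (d : Order.disp_t) (T : orderType d) (c : T -> 'I_k).
Implicit Types (r : nat -> seq T) (J : {set 'I_k}).
Hypotheses (lcpA : LCP A) (transA : transversal_family A).

Definition converges r : Prop :=
  exists L, mx_limit (fun i => word_value A (map c (r i))) L.

Lemma converges_cut (D : pred T) r : (forall x y, (x < y)%O -> D y -> D x) ->
  chain r -> converges (fun i => seq.filter D (r i)) ->
  converges (fun i => seq.filter (predC D) (r i)) -> converges r.
Proof.
move=> downD [sr _] [L DL] [M DM]; exists (L *m M).
move=> e /(mx_limitM DL DM)[N NP]; exists N => m /NP.
by rewrite -word_value_cat -map_cat -filter_downset.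
Qed.

(** Each cut removes either a letter from the alphabet, where [IHJ] takes over,
    or the first letter from the avoided word, where the induction on [z] does. *)
Lemma converges_avoiding J (z : seq 'I_k) r :
  (forall a r', a \in J -> chain r' ->
    (forall i x, x \in r' i -> c x \in J :\ a) -> converges r') ->
  all (mem J) z -> chain r -> (forall i x, x \in r i -> c x \in J) ->
  (forall i, ~~ subseq z (map c (r i))) -> converges r.
Proof.
move=> IHJ; elim: z r => [|a z IHz] r /=.
  by move=> _ _ _ /(_ 0%N); rewrite sub0seq.
move=> /andP[aJ zJ] chr rJ avoid; have [sr subr] := chr.
have no_a (D : pred T) : (forall i x, x \in r i -> D x -> c x != a) ->
    converges (fun i => seq.filter D (r i)).
  move=> Da; apply: (IHJ a) => //; first exact: chain_filter.
  move=> i x; rewrite mem_filter !inE => /andP[Dx xr].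
  by rewrite (rJ i)// andbT (Da i).
have below y i s i' : y \in r i -> c y = a -> sorted <%O s ->
    {subset s <= r i'} -> all (> y)%O s -> ~ subseq z (map c s).
  move=> yr cy ss sr' ys zs; have /negP := avoid (maxn i i'); apply.
  have yss : subseq (y :: s) (r (maxn i i')).
    apply: sorted_subset_subseq => //; first by rewrite /= path_min_sorted.
    move=> x; rewrite inE => /predU1P[->|/sr'].
      exact: (chain_le chr (leq_maxl _ _)).
    exact: (chain_le chr (leq_maxr _ _)).
  apply: subseq_trans (map_subseq c yss).
  by rewrite /= cy eqxx.
(* A point carrying [a] strictly to the left of an occurrence of [z] would give
   an occurrence of [a :: z] at a later stage; this is [below]. *)
have [[y [i0 [yr cy first_y]]]|no_first] := pselect (exists y i,
    [/\ y \in r i, c y = a & forall i' x, x \in r i' -> (x < y)%O -> c x != a]).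
  apply: (@converges_cut (<= y)%O) => //.
  - by move=> x x' xx' /(lt_le_trans xx')/ltW.
  - apply: (@converges_cut (< y)%O) => //; first by move=> x x'; apply: lt_trans.
    + exact: chain_filter.
    + rewrite (_ : (fun i => _) = fun i => seq.filter (< y)%O (r i)); last first.
        apply/funext => i; rewrite -filter_predI; apply: eq_filter => x /=.
        by rewrite andb_idr// => /ltW.
      by apply: no_a => i x xr xy; apply: first_y xr xy.
    + exists (word_value A [:: c y]); apply: (@mx_limit_near_cst _ _ _ _ i0) => m im.
      rewrite (_ : seq.filter _ _ = [:: y])//; apply: lt_sorted_eq => //.
        by do 2!apply: lt_sorted_filter.
      move=> x; rewrite !mem_filter mem_seq1 /= -leNgt andbA -eq_le eq_sym.
      by case: eqP => [->|//]; apply: (chain_le chr im).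
  - apply: IHz => //; first exact: chain_filter.
      by move=> i x; rewrite mem_filter => /andP[_ /rJ].
    move=> i; apply/negP; apply: (below y i0 _ i) => //.
    + exact: lt_sorted_filter.
    + by move=> x; rewrite mem_filter => /andP[].
    + by apply/allP => x; rewrite mem_filter /= -ltNge => /andP[].
(* With no first point carrying [a], the cut is at the infimum of such points:
   [D] consists of the points having no [a] at or before them. *)
pose D x := `[< forall i y, y \in r i -> (y <= x)%O -> c y != a>].
have [never|some_a] := pselect (forall i x, x \in r i -> c x != a).
  have := no_a xpredT (fun i x xr _ => never i x xr).
  by under eq_fun do rewrite filter_predT.
apply: (@converges_cut D) => //.
- move=> x x' xx' /asboolP Dx'; apply/asboolP => i y yr yx.
  by apply: Dx' yr _; apply: le_trans yx (ltW xx').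
- by apply: no_a => i x xr /asboolP /(_ i x xr); apply.
apply: IHz => //; first exact: chain_filter.
  by move=> i x; rewrite mem_filter => /andP[_ /rJ].
move=> i; apply/negP => zi; apply: some_a => i0 y0 y0r; apply/eqP => cy0.
(* The case of an empty right side matters when [z] is empty: then any
   occurrence of [a] already contradicts the avoidance of [a :: z]. *)
case E : (seq.filter (predC D) (r i)) zi => [|x s] zs.
  by apply: (below y0 i0 [::] i0) zs.
have ss : sorted <%O (x :: s) by rewrite -E; apply: lt_sorted_filter.
have sub_s : {subset x :: s <= r i}.
  by move=> y; rewrite -E mem_filter => /andP[].
have : x \in seq.filter (predC D) (r i) by rewrite E mem_head.
rewrite mem_filter => /andP[/asboolPn Dx _].
apply: Dx => i1 y1 y1r y1x; apply/eqP => cy1.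
apply: no_first; exists y1, i1; split=> // i2 y2 y2r y21; apply/eqP => cy2.
apply: (below y2 i2 (x :: s) i) => //=.
have y2x := lt_le_trans y21 y1x; rewrite y2x /=.
apply: sub_all (order_path_min lt_trans ss) => y.
exact: lt_trans.
Qed.

Theorem chain_converges r : chain r -> converges r.
Proof.
move=> chr; have : forall i x, x \in r i -> c x \in [set: 'I_k]%SET.
  by move=> i x _; rewrite inE.
move: [set: 'I_k]%SET chr => J; have [m] := ubnP #|J|.
elim: m J r => // m IHm J r; rewrite ltnS => Jm chr rJ.
have [often|] := pselect (forall q, exists i,
    subseq (alphabet_power J q) (map c (r i))).
  have [P fixP] := transversal_projection J transA.
  exists P => e e0.
  have [q qP] := complete_words_near_projection fixP lcpA e0.
  have [i qi] := often q; exists i => m' im'; apply: qP.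
    by apply/allP => b /mapP[x xr ->]; apply: rJ xr.
  apply: subseq_trans qi (map_subseq c _).
  apply: sorted_subset_subseq; [exact: chr.1|exact: chr.1|exact: chain_le].
move=> /existsNP[q /forallNP avoid].
apply: (@converges_avoiding J (alphabet_power J q)) => //.
- move=> a r' aJ; apply: IHm.
  by rewrite (leq_trans _ Jm)// (cardsD1 a J) aJ.
- by apply/allP => b /flattenP[s /nseqP[-> _]]; rewrite mem_enum.
- by move=> i; apply/negP.
Qed.

End ChainConvergence.

(** * Labelling insertions by rational numbers *)

Section Labelling.

Lemma between_seqs (F : realFieldType) (s t : seq F) :
  pairwise <%R (s ++ t) -> exists x, all (< x) s && all (> x) t.
Proof.
case/lastP: s => [|s y]; case: t => [|z t].
- by exists 0.
- move=> /andP[zt _]; have z1 : z - 1 < z by rewrite gtrBl.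
  by exists (z - 1); rewrite /= z1; apply: sub_all zt => u; apply: lt_trans.
- rewrite cats0 pairwise_rcons => /andP[sy _]; have y1 : y < y + 1 by rewrite ltrDl.
  exists (y + 1); rewrite all_rcons /= y1 andbT.
  by apply: sub_all sy => u /lt_trans; apply.
rewrite pairwise_cat pairwise_rcons /= => /and3P[/allrelP yz /andP[sy _] /andP[zt _]].
have {yz}yz : y < z by apply: yz; rewrite ?mem_rcons mem_head.
have [yx xz] := midf_lt yz; exists ((y + z) / 2%:R).
rewrite all_rcons /= yx xz; apply/andP; split.
  by apply: sub_all sy => u /lt_trans; apply.
by apply: sub_all zt => u; apply: lt_trans.
Qed.

(** A letter is kept together with its label: the lexicographic order on the pairs
    is then the order of the labels, and the letter of a point is its second
    component. Density of the rationals leaves room for each insertion. *)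
Lemma chain_of_insertions k (u : nat -> seq 'I_k) :
  (forall i, exists m j, u i.+1 = take m (u i) ++ j :: drop m (u i)) ->
  size (u 0%N) = 1%N ->
  exists r : nat -> seq (rat *l 'I_k), chain r /\
    forall i, map snd (r i) = u i.
Proof.
move=> ins u0.
pose good i (p : seq (rat * 'I_k)) :=
  pairwise <%R (map fst p) /\ map snd p = u i.
have [p0 good0] : exists p, good 0%N p.
  by rewrite /good; case: (u 0%N) u0 => [|a []]// _; exists [:: (0, a)].
pose next (x y : {ip : nat * seq (rat * 'I_k) | good ip.1 ip.2}) :=
  (sval y).1 = (sval x).1.+1 /\ {subset (sval x).2 <= (sval y).2}.
have [x|f [f0 fS]] := @dependent_choice _ next _ (exist _ (0%N, p0) good0).
  apply: cid; case: x => -[i p] /= [sp up].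
  have [m [j uS]] := ins i.
  have := sp; rewrite -{1}(cat_take_drop m p) map_cat => /[dup] /between_seqs.
  move=> [x /andP[mx xm]]; rewrite pairwise_cat => /and3P[mm sm sm'].
  have good' : good i.+1 (take m p ++ (x, j) :: drop m p).
    split; last by rewrite map_cat /= map_take map_drop up uS.
    rewrite map_cat pairwise_cat /= sm sm' xm allrel_consr mm !andbT.
    exact: mx.
  exists (exist _ (i.+1, take m p ++ (x, j) :: drop m p) good').
  split=> //= q; rewrite -{1}(cat_take_drop m p) !mem_cat inE => /orP[->//|->].
  by rewrite !orbT.
have f1 i : (sval (f i)).1 = i by elim: i => [|i IHi]; rewrite ?f0// (fS i).1 IHi.
exists (fun i => (sval (f i)).2); split; last first.
  by move=> i; have [_] := svalP (f i); rewrite f1.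
split=> i; last exact: (fS i).2.
have [+ _] := svalP (f i); rewrite -lt_sorted_pairwise sorted_map.
apply: sub_sorted => x y /= xy; rewrite ltEprodlexi (ltW xy) /=.
by rewrite leNgt xy.
Qed.

End Labelling.

Unset Implicit Arguments.

Theorem theorem5p1 (R : realType) (n k : nat) (A : 'I_k -> 'M[R]_n)
  (hA : CP A)
  (w : nat -> seq 'I_k)
  (hsize : forall i : nat, (1 <= i)%N -> size (w i) = i)
  (hinsert : forall i : nat, (1 <= i)%N ->
    exists (m : nat) (j : 'I_k),
      (m <= i)%N /\ w i.+1 = take m (w i) ++ j :: drop m (w i)) :
  exists M : 'M[R]_n, (fun i : nat => word_value A (w i)) @ \oo --> M.
Proof.
have [lcpA _ transA] := hA.
have [i||r [chr ru]] := @chain_of_insertions k (fun i => w i.+1).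
- by have [m [j [_ wS]]] := hinsert i.+1 isT; exists m, j.
- exact: hsize.
have [M rM] := chain_converges (fun x : rat *l 'I_k => x.2) lcpA transA chr.
exists M; apply/mx_limitP => e /rM[N NP]; exists N.+1 => -[//|m] Nm.
by have := NP m Nm; rewrite ru.
Qed.
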